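(* If $M$ is any nonstandard model of $\mathrm{PA}$, then every countable model of set theory is isomorphic to a submodel of the hereditarily finite sets $\langle \mathrm{HF}^M,\in^M\rangle$ of $M$. Indeed, $\langle \mathrm{HF}^M,\in^M\rangle$ is universal for all countable acyclic binary relations: for every countable set $G$ with an acyclic binary relation $\rightharpoonup$ on it, the structure $\langle G,\rightharpoonup\rangle$ is isomorphic to a submodel of $\langle \mathrm{HF}^M,\in^M\rangle$.
   Context: For a model $M$ of arithmetic, $\langle\mathrm{HF}^M,\in^M\rangle$ is the structure obtained in $M$ by Ackermann coding: its elements are the elements of $M$, and $n\in^M m$ holds iff $M$ satisfies ''the $n$-th binary bit of $m$ is $1$''. A binary relation $\rightharpoonup$ on $G$ is acyclic if there is no finite directed path (of length at least one) from a point of $G$ to itself. A submodel of a structure with a binary relation is an arbitrary subset with the restricted relation (an induced substructure). A model of set theory is a first-order structure $\langle N,\in^N\rangle$ satisfying at least the Kripke–Platek axioms KP; it need not be well-founded. *)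

(* Defs.v *)
From mathcomp Require Import all_boot.
From mathcomp Require Import boolp classical_sets cardinality.
From Stdlib Require Import Relation_Operators.

Set Implicit Arguments.
Unset Strict Implicit.
Unset Printing Implicit Defensive.

(* First-order formulas over a type of atomic formulas, with de Bruijn
   variables: a quantifier binds variable 0 and shifts the others by one. *)
Inductive formula (atom : Type) : Type :=
| Atom of atom
| Bot
| Imp of formula atom & formula atom
| And of formula atom & formula atom
| Or of formula atom & formula atom
| All of formula atom
| Ex of formula atom.

Arguments Bot {atom}.

Definition scons (D : Type) (d : D) (e : nat -> D) : nat -> D :=
  fun n => if n is k.+1 then e k else d.

Notation "d .: e" := (scons d e) (at level 55, right associativity).

Fixpoint sat (D atom : Type) (val : (nat -> D) -> atom -> Prop)
    (e : nat -> D) (p : formula atom) : Prop :=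
  match p with
  | Atom a => val e a
  | Bot => False
  | Imp q r => sat val e q -> sat val e r
  | And q r => sat val e q /\ sat val e r
  | Or q r => sat val e q \/ sat val e r
  | All q => forall d, sat val (d .: e) q
  | Ex q => exists d, sat val (d .: e) q
  end.

Record arith := Arith {
  acarrier :> Type;
  azero : acarrier;
  asucc : acarrier -> acarrier;
  aadd : acarrier -> acarrier -> acarrier;
  amul : acarrier -> acarrier -> acarrier }.

Arguments azero {_}.

Inductive aterm : Type :=
| AVar of nat
| AZero
| ASucc of aterm
| AAdd of aterm & aterm
| AMul of aterm & aterm.

Inductive aatom : Type := AEq of aterm & aterm.

Fixpoint aeval (M : arith) (e : nat -> M) (t : aterm) : M :=
  match t with
  | AVar n => e n
  | AZero => azero
  | ASucc u => asucc (aeval e u)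
  | AAdd u v => aadd (aeval e u) (aeval e v)
  | AMul u v => amul (aeval e u) (aeval e v)
  end.

Definition aatom_val (M : arith) (e : nat -> M) (a : aatom) : Prop :=
  let: AEq t u := a in aeval e t = aeval e u.

Definition asat (M : arith) (e : nat -> M) (p : formula aatom) : Prop :=
  sat (@aatom_val M) e p.

(* In the induction scheme variable 0 of [p] is the induction variable; the
   remaining variables are parameters, evaluated by [e]. *)
Record PA_model (M : arith) : Prop := {
  PA_succ_neq0 : forall x : M, asucc x <> azero;
  PA_succ_inj : forall x y : M, asucc x = asucc y -> x = y;
  PA_add0 : forall x : M, aadd x azero = x;
  PA_addS : forall x y : M, aadd x (asucc y) = asucc (aadd x y);
  PA_mul0 : forall x : M, amul x azero = azero;
  PA_mulS : forall x y : M, amul x (asucc y) = aadd (amul x y) x;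
  PA_ind : forall (p : formula aatom) (e : nat -> M),
    asat (azero .: e) p ->
    (forall x : M, asat (x .: e) p -> asat (asucc x .: e) p) ->
    forall x : M, asat (x .: e) p }.

Definition nat_arith : arith := Arith 0 S addn muln.

Definition arith_isomorphic (M N : arith) : Prop :=
  exists f : M -> N,
    [/\ bijective f, f azero = azero,
        forall x, f (asucc x) = asucc (f x),
        forall x y, f (aadd x y) = aadd (f x) (f y) &
        forall x y, f (amul x y) = amul (f x) (f y)].

Definition nonstandard (M : arith) : Prop := ~ arith_isomorphic nat_arith M.

Fixpoint alift (t : aterm) : aterm :=
  match t with
  | AVar n => AVar n.+1
  | AZero => AZero
  | ASucc u => ASucc (alift u)
  | AAdd u v => AAdd (alift u) (alift v)
  | AMul u v => AMul (alift u) (alift v)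
  end.

Definition f_eq (t u : aterm) : formula aatom := Atom (AEq t u).

Definition f_lt (t u : aterm) : formula aatom :=
  Ex (f_eq (AAdd (alift t) (ASucc (AVar 0))) (alift u)).

(* Goedel's beta function: v = a mod (1 + (i + 1) b). *)
Definition f_beta (a b i v : aterm) : formula aatom :=
  let m := ASucc (AMul (ASucc i) b) in
  And (Ex (f_eq (alift a) (AAdd (AMul (AVar 0) (alift m)) (alift v))))
      (f_lt v m).

(* p = 2 ^ n: some beta-coded sequence starts with 1, doubles at each step
   below n, and has n-th term p. *)
Definition f_exp2 (n p : aterm) : formula aatom :=
  let n2 := alift (alift n) in
  let p2 := alift (alift p) in
  Ex (Ex (And (f_beta (AVar 1) (AVar 0) AZero (ASucc AZero))
         (And (All (Imp (f_lt (AVar 0) (alift n2))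
                 (Ex (And (f_beta (AVar 3) (AVar 2) (AVar 1) (AVar 0))
                          (f_beta (AVar 3) (AVar 2) (ASucc (AVar 1))
                                  (AAdd (AVar 0) (AVar 0)))))))
              (f_beta (AVar 1) (AVar 0) n2 p2)))).

(* The n-th binary bit of m is 1, with n = variable 0 and m = variable 1:
   m = (2 q + 1) p + r with p = 2 ^ n and r < p. *)
Definition f_bit : formula aatom :=
  Ex (Ex (Ex (And (f_exp2 (AVar 3) (AVar 2))
             (And (f_lt (AVar 0) (AVar 2))
                  (f_eq (AVar 4)
                     (AAdd (AMul (ASucc (AAdd (AVar 1) (AVar 1))) (AVar 2))
                           (AVar 0))))))).

Definition HF_mem (M : arith) (n m : M) : Prop :=
  asat (n .: m .: fun=> azero) f_bit.

(* [HF_mem] with the satisfaction relation computed away. *)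
Section Unfolding.
Variable M : arith.
Implicit Types n m p a b i v : M.

Definition alt n m : Prop := exists d, aadd n (asucc d) = m.

Definition abeta a b i v : Prop :=
  let m := asucc (amul (asucc i) b) in
  (exists q, a = aadd (amul q m) v) /\ alt v m.

Definition aexp2 n p : Prop :=
  exists a b,
    abeta a b azero (asucc azero) /\
    (forall i, alt i n ->
       exists v, abeta a b i v /\ abeta a b (asucc i) (aadd v v)) /\
    abeta a b n p.

Lemma HF_memE n m :
  HF_mem n m =
  (exists p q r, aexp2 n p /\ alt r p /\
     m = aadd (amul (asucc (aadd q q)) p) r).
Proof. by []. Qed.

End Unfolding.

Inductive satom : Type :=
| SMem of nat & nat
| SEq of nat & nat.

Definition satom_val (N : Type) (E : N -> N -> Prop) (e : nat -> N)
    (a : satom) : Prop :=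
  match a with
  | SMem i j => E (e i) (e j)
  | SEq i j => e i = e j
  end.

Definition ssat (N : Type) (E : N -> N -> Prop) (e : nat -> N)
    (p : formula satom) : Prop :=
  sat (satom_val E) e p.

(* The bound [k.+1] is variable [k] of the context outside the quantifier. *)
Inductive Delta0 : formula satom -> Prop :=
| Delta0_atom a : Delta0 (Atom a)
| Delta0_bot : Delta0 Bot
| Delta0_imp p q : Delta0 p -> Delta0 q -> Delta0 (Imp p q)
| Delta0_and p q : Delta0 p -> Delta0 q -> Delta0 (And p q)
| Delta0_or p q : Delta0 p -> Delta0 q -> Delta0 (Or p q)
| Delta0_all k p : Delta0 p -> Delta0 (All (Imp (Atom (SMem 0 k.+1)) p))
| Delta0_ex k p : Delta0 p -> Delta0 (Ex (And (Atom (SMem 0 k.+1)) p)).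

(* Kripke-Platek set theory, without the axiom of infinity. Variables of the
   formulas [p] not set explicitly are parameters, evaluated by [e]. *)
Record KP_model (N : Type) (E : N -> N -> Prop) : Prop := {
  KP_ext : forall x y, (forall z, E z x <-> E z y) -> x = y;
  KP_empty : exists x, forall z, ~ E z x;
  KP_pair : forall x y, exists a, forall z, E z a <-> z = x \/ z = y;
  KP_union : forall x, exists u, forall z, E z u <-> exists2 y, E y x & E z y;
  KP_separation : forall p (e : nat -> N), Delta0 p ->
    forall a, exists b, forall x, E x b <-> E x a /\ ssat E (x .: e) p;
  KP_collection : forall p (e : nat -> N), Delta0 p ->
    forall a,
      (forall x, E x a -> exists y, ssat E (y .: x .: e) p) ->
      exists b, forall x, E x a -> exists2 y, E y b & ssat E (y .: x .: e) p;
  KP_foundation : forall p (e : nat -> N),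
    (exists x, ssat E (x .: e) p) ->
    exists2 x, ssat E (x .: e) p & forall y, E y x -> ~ ssat E (y .: e) p }.

Definition acyclic (G : Type) (R : G -> G -> Prop) : Prop :=
  forall x, ~ clos_trans G R x x.

Definition isomorphic (G H : Type) (R : G -> G -> Prop) (S : H -> H -> Prop) :
    Prop :=
  exists2 f : G -> H, bijective f & forall x y, R x y <-> S (f x) (f y).

Definition induced (H : Type) (S : H -> H -> Prop) (A : set H) :
    set_type A -> set_type A -> Prop :=
  fun x y => S (val x) (val y).

Definition isomorphic_to_submodel (G H : Type) (R : G -> G -> Prop)
    (S : H -> H -> Prop) : Prop :=
  exists A : set H, isomorphic R (induced S (A := A)).

(* Main.v *)
(* Models of KP are acyclic, because a cycle would be a definable nonempty class
   without minimal element. For an acyclic relation R on G = {g_0, g_1, ...} and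
   a nonstandard c, sets X_0, X_1, ... in HF^M are chosen one after the other.
   First, g_n gets a level l_n < c, increasing along R: each new level is put in
   the middle of a gap of nonstandard length. Let B_n = T(l_n) for a tower
   function T, so that every subset of [0, B_m) has a code below B_n whenever
   R g_m g_n. Then X_n is a subset of [0, B_n) containing the right ones among
   the earlier X_k; apart from these and finitely many other exceptions, X_n
   contains x iff the standard number n is an element of x, and the later sets
   are given the right standard elements. Such an X_n exists by comprehension
   in M; the functions 2^n and T come from definable recursion, that is, from
   Goedel's beta function. *)

Require Import Defs.
From mathcomp Require Import all_boot.
From mathcomp Require Import boolp classical_sets cardinality.
From Stdlib Require Import Relation_Operators Ring.

Set Implicit Arguments.
Unset Strict Implicit.
Unset Printing Implicit Defensive.

(** Each choice may consult all earlier ones. The table [F l] holds the first [l] choices and [a0]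
    beyond them; by the first hypothesis [Q l] looks only at that part. *)
Lemma recursive_choice (A : Type) (a0 : A)
    (Q : nat -> (nat -> A) -> A -> Prop) :
  (forall l f g v, (forall k, k < l -> f k = g k) -> Q l f v -> Q l g v) ->
  (forall l f, (forall k, k < l -> Q k f (f k)) -> exists v, Q l f v) ->
  exists f, forall l, Q l f (f l).
Proof.
move=> ext step.
pose next l f :=
  if pselect (exists v, Q l f v) is left h then projT1 (cid h) else a0.
pose F := fix F l := if l is k.+1 then
  (fun i => if i == k then next k (F k) else F k i) else fun=> a0.
pose f l := F l.+1 l.
have Ff l k : k < l -> F l k = f k.
  elim: l => // l IH; rewrite ltnS leq_eqVlt => /orP[/eqP -> //|kl] /=.
  by rewrite (ltn_eqF kl) IH.
exists f; elim/ltn_ind => l IH; have [v hv] := step l f IH.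
have h : exists v, Q l (F l) v.
  by exists v; apply: ext hv => k /Ff.
apply: (ext l (F l)) => [k /Ff //|]; rewrite /f /= eqxx /next.
by case: pselect => // h'; case: cid.
Qed.

(** * Definability with parameters *)

Definition up (r : nat -> nat) : nat -> nat :=
  fun n => if n is k.+1 then (r k).+1 else 0.

Fixpoint tren (r : nat -> nat) (t : aterm) : aterm :=
  match t with
  | AVar n => AVar (r n)
  | AZero => AZero
  | ASucc u => ASucc (tren r u)
  | AAdd u v => AAdd (tren r u) (tren r v)
  | AMul u v => AMul (tren r u) (tren r v)
  end.

Fixpoint fren (r : nat -> nat) (p : formula aatom) : formula aatom :=
  match p with
  | Atom (AEq t u) => Atom (AEq (tren r t) (tren r u))
  | Bot => Bot
  | Imp p q => Imp (fren r p) (fren r q)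
  | And p q => And (fren r p) (fren r q)
  | Or p q => Or (fren r p) (fren r q)
  | All p => All (fren (up r) p)
  | Ex p => Ex (fren (up r) p)
  end.

(* Environments interleaving variables (even positions) and parameters (odd
   positions). *)
Definition mix (D : Type) (e c : nat -> D) : nat -> D :=
  fun n => if odd n then c n./2 else e n./2.

Section Definability.
Variable M : arith.
Implicit Types (e c : nat -> M) (P Q : (nat -> M) -> Prop).
Implicit Types (s t u v : (nat -> M) -> M).

Lemma aeval_tren r e (t : aterm) : aeval e (tren r t) = aeval (fun n => e (r n)) t.
Proof. by elim: t => //= [u ->|u -> v ->|u -> v ->]. Qed.

Lemma scons_up (d : M) e r :
  (fun n => (d .: e) (up r n)) = (d .: (fun n => e (r n))).
Proof. by apply: funext => -[]. Qed.

Lemma asat_fren r e p : asat e (fren r p) <-> asat (fun n => e (r n)) p.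
Proof.
rewrite /asat.
elim: p r e
  => [[t u]||p IHp q IHq|p IHp q IHq|p IHp q IHq|p IHp|p IHp] r e //=.
- by rewrite !aeval_tren.
- by rewrite IHp IHq.
- by rewrite IHp IHq.
- by rewrite IHp IHq.
- by split=> H d; have := H d; rewrite IHp scons_up.
- by split=> -[d H]; exists d; move: H; rewrite IHp scons_up.
Qed.

(** Definability is a property of predicates of the metalanguage, so that closure rules replace the
    writing of formulas. As [p] mentions only finitely many entries of [c], this is ordinary
    definability with parameters. *)
Definition Def P := exists p c, forall e, P e <-> asat (mix e c) p.

(* A function of the environment is definable if its graph is; the value is
   variable 0. *)
Definition DefF t := Def (fun e => e 0 = t (fun n => e n.+1)).

Definition Def1 (A : M -> Prop) := Def (fun e => A (e 0)).
Definition DefF1 (f : M -> M) := DefF (fun e => f (e 0)).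

Lemma Def_ext P Q : (forall e, P e <-> Q e) -> Def P -> Def Q.
Proof. by move=> PQ [p [c H]]; exists p, c => e; rewrite -PQ. Qed.

Lemma Def_ren r P : Def P -> Def (fun e => P (fun n => e (r n))).
Proof.
move=> [p [c H]]; exists (fren (fun n => if odd n then n else (r n./2).*2) p), c.
move=> e; rewrite H asat_fren; set a := mix _ _; set b := fun n => _.
suff -> : a = b by [].
apply: funext => n; rewrite /a /b /mix; case: ifPn => [->//|_].
by rewrite odd_double doubleK.
Qed.

Lemma odd_double1 n : odd n.*2.+1 = true.
Proof. by rewrite oddS odd_double. Qed.

Lemma half_double1 n : n.*2.+1./2 = n.
Proof. exact: uphalf_double. Qed.

(** The two parameter sequences are interleaved: the parameters of [P] move to the even places of
    the common sequence, those of [Q] to the odd places. *)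
Lemma Def_common P Q : Def P -> Def Q -> exists p q c,
  (forall e, P e <-> asat (mix e c) p) /\ (forall e, Q e <-> asat (mix e c) q).
Proof.
move=> [p [c Hp]] [q [c' Hq]].
exists (fren (fun n => if odd n then (n./2.*2).*2.+1 else n) p).
exists (fren (fun n => if odd n then (n./2.*2.+1).*2.+1 else n) q).
exists (mix c c').
split=> e; rewrite ?Hp ?Hq asat_fren; set a := mix _ _; set b := fun n => _.
- suff -> : a = b by [].
  apply: funext => n; rewrite /a /b /mix; case: ifPn => [_|/negbTE ->//].
  by rewrite odd_double1 half_double1 odd_double doubleK.
- suff -> : a = b by [].
  apply: funext => n; rewrite /a /b /mix; case: ifPn => [_|/negbTE ->//].
  by rewrite !(odd_double1, half_double1).
Qed.

Lemma Def_and P Q : Def P -> Def Q -> Def (fun e => P e /\ Q e).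
Proof.
move=> hP hQ; have [p [q [c [Hp Hq]]]] := Def_common hP hQ.
by exists (And p q), c => e; rewrite Hp Hq.
Qed.

Lemma Def_or P Q : Def P -> Def Q -> Def (fun e => P e \/ Q e).
Proof.
move=> hP hQ; have [p [q [c [Hp Hq]]]] := Def_common hP hQ.
by exists (Or p q), c => e; rewrite Hp Hq.
Qed.

Lemma Def_imp P Q : Def P -> Def Q -> Def (fun e => P e -> Q e).
Proof.
move=> hP hQ; have [p [q [c [Hp Hq]]]] := Def_common hP hQ.
by exists (Imp p q), c => e; rewrite Hp Hq.
Qed.

Lemma Def_iff P Q : Def P -> Def Q -> Def (fun e => P e <-> Q e).
Proof. by move=> hP hQ; apply: Def_and; apply: Def_imp. Qed.

(** The truth value is decided in the metatheory. Hence facts such as [R k l] for fixed [k] and [l]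
    may occur in definable predicates, although [R] is no relation of [M]. *)
Lemma Def_prop (A : Prop) : Def (fun=> A).
Proof.
case: (pselect A) => a.
- by exists (Imp Bot Bot), (fun=> azero) => e; split=> // _ [].
- by exists Bot, (fun=> azero) => e; split=> // [].
Qed.

Lemma Def_not P : Def P -> Def (fun e => ~ P e).
Proof. by move=> hP; apply: Def_imp hP (Def_prop False). Qed.

(** A quantifier pushes its value in front of the mixed environment and so exchanges the parities of
    the other places. The renaming undoes this; [0.-1 = 0] keeps the bound variable in place. *)
Lemma mix_scons x e c :
  mix (x .: e) c = (fun n => (x .: mix e c) (if odd n then n.+1 else n.-1)).
Proof.
apply: funext => -[|[|n]] //; rewrite /mix /=; case: (boolP (odd n)) => h /=.
  by rewrite h.
by rewrite (negbTE h).
Qed.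

Lemma Def_scons_all P : Def P -> Def (fun e => forall x, P (x .: e)).
Proof.
move=> [p [c H]].
exists (All (fren (fun n => if odd n then n.+1 else n.-1) p)), c => e.
split=> h d; first by apply/asat_fren; rewrite -mix_scons; apply/H.
by move/asat_fren: (h d); rewrite -mix_scons => /H.
Qed.

Lemma Def_scons_ex P : Def P -> Def (fun e => exists x, P (x .: e)).
Proof.
move=> [p [c H]].
exists (Ex (fren (fun n => if odd n then n.+1 else n.-1) p)), c => e.
split=> -[d h]; exists d; first by apply/asat_fren; rewrite -mix_scons; apply/H.
by move/asat_fren: h; rewrite -mix_scons => /H.
Qed.

Lemma Def_ex (P : M -> (nat -> M) -> Prop) :
  Def (fun e => P (e 0) (fun n => e n.+1)) -> Def (fun e => exists x, P x e).
Proof. exact: Def_scons_ex. Qed.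

Lemma Def_all (P : M -> (nat -> M) -> Prop) :
  Def (fun e => P (e 0) (fun n => e n.+1)) -> Def (fun e => forall x, P x e).
Proof. exact: Def_scons_all. Qed.

Lemma Def_atom (t u : aterm) : Def (fun e => aeval e t = aeval e u).
Proof.
exists (fren double (Atom (AEq t u))), (fun=> azero) => e.
rewrite asat_fren /asat /=; set a := fun n => _; suff -> : a = e by [].
by apply: funext => n; rewrite /a /mix odd_double doubleK.
Qed.

(** Only the graph of [t] is given by a formula, so its value is introduced by an existential
    quantifier. *)
Lemma Def_subst P t : DefF t -> Def P -> Def (fun e => P (t e .: e)).
Proof.
move=> ht hP; apply: (@Def_ext (fun e => exists x, x = t e /\ P (x .: e))).
  by move=> e; split=> [[x [->]]//|h]; exists (t e).
apply: Def_ex; apply: Def_and => //; apply: Def_ext hP => e.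
by suff -> : (e 0 .: (fun n => e n.+1)) = e by []; apply: funext => -[].
Qed.

Lemma DefF_shift t : DefF t -> DefF (fun e => t (fun n => e n.+1)).
Proof.
exact: (@Def_ren (fun n => if n is k.+1 then k.+2 else 0)).
Qed.

Lemma Def_app1 (A : M -> Prop) s : Def1 A -> DefF s -> Def (fun e => A (s e)).
Proof. by move=> hA hs; apply: (Def_subst hs hA). Qed.

(** Substitution fills variable 0 only; a renaming therefore reverses the arguments, which are then
    filled from the last to the first. *)
Lemma Def_app2 (A : M -> M -> Prop) s t :
  Def (fun e => A (e 0) (e 1)) -> DefF s -> DefF t ->
  Def (fun e => A (s e) (t e)).
Proof.
move=> hA hs ht.
have h := Def_subst (DefF_shift ht)
  (@Def_ren (fun n => if n is 0 then 1 else 0) _ hA).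
exact: (Def_subst hs h).
Qed.

Lemma Def_app3 (A : M -> M -> M -> Prop) s t u :
  Def (fun e => A (e 0) (e 1) (e 2)) -> DefF s -> DefF t -> DefF u ->
  Def (fun e => A (s e) (t e) (u e)).
Proof.
move=> hA hs ht hu.
have h := Def_subst (DefF_shift (DefF_shift hu))
  (@Def_ren (fun n => match n with 0 => 2 | 1 => 1 | _ => 0 end) _ hA).
exact: (Def_subst hs (Def_subst (DefF_shift ht) h)).
Qed.

Lemma Def_app4 (A : M -> M -> M -> M -> Prop) s t u v :
  Def (fun e => A (e 0) (e 1) (e 2) (e 3)) -> 
  DefF s -> DefF t -> DefF u -> DefF v ->
  Def (fun e => A (s e) (t e) (u e) (v e)).
Proof.
move=> hA hs ht hu hv.
have h := Def_subst (DefF_shift (DefF_shift (DefF_shift hv)))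
  (@Def_ren (fun n => match n with 0 => 3 | 1 => 2 | 2 => 1 | _ => 0 end) _ hA).
exact: (Def_subst hs (Def_subst (DefF_shift ht)
         (Def_subst (DefF_shift (DefF_shift hu)) h))).
Qed.

Lemma Def_eq s t : DefF s -> DefF t -> Def (fun e => s e = t e).
Proof. by apply: Def_app2; apply: (Def_atom (AVar 0) (AVar 1)). Qed.

Lemma DefF_var n : DefF (fun e => e n).
Proof. exact: (Def_atom (AVar 0) (AVar n.+1)). Qed.

Lemma DefF_const x : DefF (fun=> x).
Proof. by exists (Atom (AEq (AVar 0) (AVar 1))), (fun=> x). Qed.

Lemma DefF_app1 (f : M -> M) s : DefF1 f -> DefF s -> DefF (fun e => f (s e)).
Proof.
move=> hf hs; apply: (@Def_app2 (fun x y => x = f y)) => //.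
- exact: DefF_var.
- exact: DefF_shift.
Qed.

Lemma DefF_app2 (f : M -> M -> M) s t :
  DefF (fun e => f (e 0) (e 1)) -> DefF s -> DefF t ->
  DefF (fun e => f (s e) (t e)).
Proof.
move=> hf hs ht; apply: (@Def_app3 (fun x y z => x = f y z)) => //.
- exact: DefF_var.
- exact: DefF_shift.
- exact: DefF_shift.
Qed.

Lemma DefF_app3 (f : M -> M -> M -> M) s t u :
  DefF (fun e => f (e 0) (e 1) (e 2)) -> DefF s -> DefF t -> DefF u ->
  DefF (fun e => f (s e) (t e) (u e)).
Proof.
move=> hf hs ht hu; apply: (@Def_app4 (fun x y z w => x = f y z w)) => //.
- exact: DefF_var.
- exact: DefF_shift.
- exact: DefF_shift.
- exact: DefF_shift.
Qed.

Lemma DefF_succ s : DefF s -> DefF (fun e => asucc (s e)).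
Proof. by apply: DefF_app1; apply: (Def_atom (AVar 0) (ASucc (AVar 1))). Qed.

Lemma DefF_add s t : DefF s -> DefF t -> DefF (fun e => aadd (s e) (t e)).
Proof.
by apply: DefF_app2; apply: (Def_atom (AVar 0) (AAdd (AVar 1) (AVar 2))).
Qed.

Lemma DefF_mul s t : DefF s -> DefF t -> DefF (fun e => amul (s e) (t e)).
Proof.
by apply: DefF_app2; apply: (Def_atom (AVar 0) (AMul (AVar 1) (AVar 2))).
Qed.

Lemma DefF_graph t (G : M -> (nat -> M) -> Prop) :
  (forall y e, G y e <-> y = t e) -> Def (fun e => G (e 0) (fun n => e n.+1)) ->
  DefF t.
Proof. by move=> hG; apply: Def_ext => e; apply: hG. Qed.

(** The bound is a standard number, so the quantifier unfolds into a finite disjunction, and [P k]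
    may vary with [k] in any way. *)
Lemma Def_bounded_ex n (P : nat -> (nat -> M) -> Prop) :
  (forall k, Def (P k)) -> Def (fun e => exists k, k < n /\ P k e).
Proof.
move=> hP; elim: n => [|n IHn].
  by apply: Def_ext (Def_prop False) => e; split=> // -[k []].
apply: Def_ext (Def_or IHn (hP n)) => e; split=> [[[k [kn h]]|h]|[k []]].
- by exists k; split=> //; apply: ltnW.
- by exists n.
- by rewrite ltnS leq_eqVlt => /orP[/eqP ->|kn h]; [right|left; exists k].
Qed.

Hypothesis hPA : PA_model M.

Lemma arith_ind (A : M -> Prop) : Def1 A ->
  A azero -> (forall x, A x -> A (asucc x)) -> forall x, A x.
Proof.
move=> [p [c H]] A0 AS.
pose c' n := mix (azero .: fun=> azero) c n.+1.
have E x : A x <-> asat (x .: c') p.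
  rewrite (H (x .: fun=> azero)); set a := mix _ _; suff -> : a = (x .: c') by [].
  by apply: funext => -[|[|n]] //; rewrite /a /c' /mix /=; case: (odd n).
move=> x; apply/E; apply: (PA_ind hPA); first exact/E.
by move=> y /E /AS /E.
Qed.

End Definability.

(** * Arithmetic in a model of PA *)

Declare Scope pa_scope.
Delimit Scope pa_scope with pa.
(* A constant of its own, so that the preprocessing of [ring] below, which
   rewrites [asucc x] to [x + 1], terminates. *)
Definition aone (M : arith) : M := asucc azero.
Arguments aone {M}.
Definition ale (M : arith) (x y : M) : Prop := exists d, y = aadd x d.

Notation "0" := azero : pa_scope.
Notation "1" := aone : pa_scope.
Notation "x + y" := (aadd x y) : pa_scope.
Notation "x * y" := (amul x y) : pa_scope.
Notation "x < y" := (alt x y) : pa_scope.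
Notation "x <= y" := (ale x y) : pa_scope.

Ltac definable_ext := fail.

Ltac definable :=
  repeat (cbv beta; match goal with
  | |- Def1 _ => rewrite /Def1
  | |- DefF1 _ => rewrite /DefF1
  | |- Def (fun=> _) => first [apply: Def_prop | fail 1]
  | |- Def (fun _ => exists _, _) => apply: Def_ex
  | |- Def (fun _ => _ /\ _) => apply: Def_and
  | |- Def (fun _ => _ \/ _) => apply: Def_or
  | |- Def (fun _ => ~ _) => apply: Def_not
  | |- Def (fun _ => _ <-> _) => apply: Def_iff
  | |- Def (fun _ => _ -> _) => apply: Def_imp
  | |- Def (fun _ => forall _, _) => apply: Def_all
  | |- Def (fun _ => _ = _) => apply: Def_eq
  | |- Def (fun _ => alt _ _) => rewrite /alt
  | |- Def (fun _ => ale _ _) => rewrite /ale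
  | h : Def1 ?A |- Def (fun e => ?A _) => apply: (Def_app1 h)
  | h : DefF1 ?f |- DefF (fun e => ?f _) => apply: (DefF_app1 h)
  | |- DefF (fun=> _) => apply: DefF_const
  | |- DefF (fun e => e _) => apply: DefF_var
  | |- DefF (fun e => asucc _) => apply: DefF_succ
  | |- DefF (fun e => aadd _ _) => apply: DefF_add
  | |- DefF (fun e => amul _ _) => apply: DefF_mul
  | |- _ => definable_ext
  end).

Section Arithmetic.
Variable M : arith.
Hypothesis hPA : PA_model M.
Implicit Types (x y z a b m n q r u v w : M) (k l : nat).
Local Open Scope pa_scope.

Let ind := arith_ind hPA.
Let add0 := PA_add0 hPA.
Let addS := PA_addS hPA.
Let mul0 := PA_mul0 hPA.
Let mulS := PA_mulS hPA.

Lemma add0x x : 0 + x = x.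
Proof.
apply: (ind (A := fun x => 0 + x = x)) x; [definable | exact: add0 | ].
by move=> x IH; rewrite addS IH.
Qed.

Lemma addSx x y : asucc x + y = asucc (x + y).
Proof.
apply: (ind (A := fun y => asucc x + y = asucc (x + y))) y; [definable | |].
  by rewrite !add0.
by move=> y IH; rewrite !addS IH.
Qed.

Lemma addC x y : x + y = y + x.
Proof.
apply: (ind (A := fun y => x + y = y + x)) y; [definable | |].
  by rewrite add0 add0x.
by move=> y IH; rewrite addS addSx IH.
Qed.

Lemma addA x y z : x + (y + z) = (x + y) + z.
Proof.
apply: (ind (A := fun z => x + (y + z) = (x + y) + z)) z; [definable | |].
  by rewrite !add0.
by move=> z IH; rewrite !addS IH.
Qed.

Lemma mul0x x : 0 * x = 0.
Proof.
apply: (ind (A := fun x => 0 * x = 0)) x; [definable | exact: mul0 | ].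
by move=> x IH; rewrite mulS IH add0.
Qed.

Lemma mulSx x y : asucc x * y = x * y + y.
Proof.
apply: (ind (A := fun y => asucc x * y = x * y + y)) y; [definable | |].
  by rewrite !mul0 add0.
move=> y IH; rewrite !mulS IH !addS -!addA; congr (asucc (_ + _)); exact: addC.
Qed.

Lemma mulC x y : x * y = y * x.
Proof.
apply: (ind (A := fun y => x * y = y * x)) y; [definable | |].
  by rewrite mul0 mul0x.
by move=> y IH; rewrite mulS mulSx IH.
Qed.

Lemma mulDx x y z : (x + y) * z = x * z + y * z.
Proof.
apply: (ind (A := fun z => (x + y) * z = x * z + y * z)) z; [definable | |].
  by rewrite !mul0 add0.
move=> z IH; rewrite !mulS IH -!addA; congr (_ + _).
by rewrite !addA [x + _]addC.
Qed.

Lemma mulA x y z : x * (y * z) = (x * y) * z.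
Proof.
apply: (ind (A := fun z => x * (y * z) = (x * y) * z)) z; [definable | |].
  by rewrite !mul0.
move=> z IH; rewrite !mulS -IH mulC mulDx; congr (_ + _); exact: mulC.
Qed.

Lemma mul1x x : 1 * x = x.
Proof. by rewrite mulSx mul0x add0x. Qed.

Lemma asuccE x : asucc x = x + 1.
Proof. by rewrite addS add0. Qed.

Lemma PA_semiring : semi_ring_theory 0 1 (@aadd M) (@amul M) (@eq M).
Proof.
split; [exact: add0x|exact: addC|exact: addA|exact: mul1x|exact: mul0x|
  exact: mulC|exact: mulA|exact: mulDx].
Qed.

Add Ring PA_ring : PA_semiring (preprocess [rewrite ?asuccE]).

Lemma addIx x y z : x + z = y + z -> x = y.
Proof.
apply: (ind (A := fun z => x + z = y + z -> x = y)) z; [definable | |].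
  by rewrite !add0.
by move=> z IH; rewrite !addS => /(PA_succ_inj hPA).
Qed.

Lemma succ_neq0 x : x + 1 <> 0.
Proof. by rewrite -asuccE; apply: PA_succ_neq0. Qed.

Lemma zero_or_succ x : x = 0 \/ exists y, x = y + 1.
Proof.
apply: (ind (A := fun x => x = 0 \/ exists y, x = y + 1)) x; [definable | |].
  by left.
by move=> x _; right; exists x; apply: asuccE.
Qed.

Lemma ltE x y : x < y <-> x + 1 <= y.
Proof. by split=> -[d]; [move=> <-|move=> ->]; exists d; ring. Qed.

Lemma lexx x : x <= x.
Proof. by exists 0; ring. Qed.

Lemma le0x x : 0 <= x.
Proof. by exists x; ring. Qed.

Lemma le_trans y x z : x <= y -> y <= z -> x <= z.
Proof. by move=> [d ->] [d' ->]; exists (d + d'); ring. Qed.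

Lemma lt_le x y : x < y -> x <= y.
Proof. by move=> [d <-]; exists (asucc d). Qed.

Lemma lt_le_trans y x z : x < y -> y <= z -> x < z.
Proof. by rewrite !ltE; apply: le_trans. Qed.

Lemma le_lt_trans y x z : x <= y -> y < z -> x < z.
Proof.
by move=> [d ->]; rewrite !ltE => -[e ->]; exists (d + e); ring.
Qed.

Lemma lt_trans y x z : x < y -> y < z -> x < z.
Proof. by move=> /lt_le; apply: le_lt_trans. Qed.

Lemma lt_irrefl x : ~ x < x.
Proof.
move=> [d H]; apply: (@PA_succ_neq0 M hPA d); apply: (@addIx _ _ x).
by rewrite addC H add0x.
Qed.

Lemma le_not_lt x y : x <= y -> ~ y < x.
Proof. by move=> h /(le_lt_trans h) /lt_irrefl. Qed.

Lemma le_antisym x y : x <= y -> y <= x -> x = y.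
Proof.
move=> [d ->]; case: (zero_or_succ d) => [->|[e ->]]; first by rewrite add0.
by move=> /le_not_lt []; exists e; ring.
Qed.

Lemma le_or_lt x y : x <= y \/ y < x.
Proof.
apply: (ind (A := fun x => x <= y \/ y < x)) x; [definable | |].
  by left; apply: le0x.
move=> x [[d ->]|h]; last by right; apply: lt_trans h _; exists 0; ring.
case: (zero_or_succ d) => [->|[e ->]]; first by right; exists 0; ring.
by left; exists e; ring.
Qed.

Lemma lt_or_eq x y : x <= y -> x < y \/ x = y.
Proof. by move=> h; case: (le_or_lt y x) => h'; [right; apply: le_antisym|left]. Qed.

Lemma leS x y : x <= y + 1 -> x <= y \/ x = y + 1.
Proof.
move=> [d e]; case: (zero_or_succ d) e => [->|[c ->]] e.
  by right; rewrite e; ring.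
by left; exists c; apply: (@addIx _ _ 1); rewrite e; ring.
Qed.

Lemma ltS x y : x < y + 1 <-> x <= y.
Proof.
rewrite ltE; split=> -[d e]; exists d; last by rewrite e; ring.
by apply: (@addIx _ _ 1); rewrite e; ring.
Qed.

Lemma lt_addS x : x < x + 1.
Proof. exact/ltS/lexx. Qed.

Lemma le_addr x y : x <= x + y.
Proof. by exists y. Qed.

Lemma not_lt0 x : ~ x < 0.
Proof. by apply: le_not_lt; apply: le0x. Qed.

Lemma leD x y u v : x <= y -> u <= v -> x + u <= y + v.
Proof. by move=> [d ->] [e ->]; exists (d + e); ring. Qed.

Lemma lt0_neq x : x <> 0 -> 0 < x.
Proof. by case: (zero_or_succ x) => [->//|[y -> _]]; exists y; ring. Qed.

Lemma le_mulr x y : 0 < y -> x <= x * y.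
Proof. by move=> [d <-]; exists (x * d); ring. Qed.

Lemma div_exists a m : 0 < m -> exists q r, a = q * m + r /\ r < m.
Proof.
move=> m0; apply: (ind (A := fun a => exists q r, a = q * m + r /\ r < m)) a;
  [definable | |].
  by exists 0, 0; split=> //; ring.
move=> a [q [r [-> /ltE /lt_or_eq [h|h]]]].
  by exists q, (r + 1); split=> //; ring.
by exists (q + 1), 0; split=> //; rewrite -h; ring.
Qed.

Lemma div_unique m q r q' r' : r < m -> r' < m ->
  q * m + r = q' * m + r' -> q = q' /\ r = r'.
Proof.
wlog: q r q' r' / q <= q'.
  move=> W h h' e; case: (le_or_lt q q') => c; first exact: W.
  by have [-> ->] := W _ _ _ _ (lt_le c) h' h (esym e).
move=> [d ->] h h' e; case: (zero_or_succ d) e => [->|[c ->]] e.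
  split; first by ring.
  by apply: (@addIx _ _ (q * m)); rewrite addC e; ring.
have er : r = m + (c * m + r').
  by apply: (@addIx _ _ (q * m)); rewrite addC e; ring.
by case: (@le_not_lt m r) => //; exists (c * m + r').
Qed.

Lemma parity q : exists k : M, q = k + k \/ q = k + k + 1.
Proof.
apply: (ind (A := fun q => exists k : M, q = k + k \/ q = k + k + 1)) q;
  [definable | |].
  by exists 0; left; ring.
by move=> q [k [->|->]]; [exists k; right; ring|exists (k + 1); left; ring].
Qed.

Lemma odd_not_even (k q : M) : k + k + 1 <> q + q.
Proof.
move=> e; have h1 : (1 : M) < 1 + 1 by exists 0; ring.
have h0 : (0 : M) < 1 + 1 by exists 1; ring.
have E : k * (1 + 1) + 1 = q * (1 + 1) + 0.
  by transitivity (q + q); [rewrite -e|]; ring.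
have [_ h] := div_unique h1 h0 E.
by apply: (@succ_neq0 azero); rewrite add0x.
Qed.

(** * Goedel's beta function and the Chinese remainder theorem in [M] *)

Lemma beta_exists a b i : exists v, abeta a b i v.
Proof.
have [|q [r [e h]]] := @div_exists a (asucc (amul (asucc i) b)).
  by exists (amul (asucc i) b); ring.
by exists r; split=> //; exists q.
Qed.

Definition bt a b i : M := projT1 (cid (beta_exists a b i)).

Lemma btP a b i v : v = bt a b i <-> abeta a b i v.
Proof.
have h : abeta a b i (bt a b i) by apply: (projT2 (cid (beta_exists a b i))).
split=> [->//|[[q e] l]]; case: h => [[q' e'] l'].
by have [] := div_unique l l' (etrans (esym e) e').
Qed.

Lemma DefF_bt (s t u : (nat -> M) -> M) : DefF s -> DefF t -> DefF u ->
  DefF (fun e => bt (s e) (t e) (u e)).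
Proof.
apply: DefF_app3.
apply: (DefF_graph (G := fun y e => abeta (e 0%N) (e 1%N) (e 2%N) y)).
  by move=> y e; rewrite btP.
by rewrite /abeta; definable.
Qed.

Ltac definable_ext ::= match goal with
  | |- DefF (fun e => bt _ _ _) => apply: DefF_bt
  end.

Lemma mul_gt0 x y : 0 < x -> 0 < y -> 0 < x * y.
Proof. by move=> [d <-] [e <-]; exists (d * e + d + e); ring. Qed.

Lemma le_x0 x : x <= 0 -> x = 0.
Proof. by move=> h; apply: le_antisym h (le0x x). Qed.

Lemma bounded_image (f : M -> M) n : DefF1 f ->
  exists B, forall i, i <= n -> f i <= B.
Proof.
move=> hf; apply: (ind (A := fun n => exists B, forall i, i <= n -> f i <= B)) n;
  [definable | |].
  by exists (f 0) => i /le_x0 ->; apply: lexx.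
move=> n [B hB]; exists (B + f (asucc n)) => i; rewrite asuccE => /leS[/hB h|->].
  by apply: le_trans h _; apply: le_addr.
by rewrite [B + _]addC; apply: le_addr.
Qed.

(** The witness built by the induction is a factorial; asking only for a common multiple keeps the
    statement arithmetical before recursion is available. *)
Lemma common_multiple n : exists b, 0 < b /\
  forall d, 0 < d -> d <= n -> exists e, b = d * e.
Proof.
apply: (ind (A := fun n => exists b, 0 < b /\
  forall d, 0 < d -> d <= n -> exists e, b = d * e)) n; [definable | |].
  exists 1; split=> [|d h /le_x0 e]; first by exists 0; ring.
  by case: (@not_lt0 0); rewrite -{2}e.
move=> n [b [b0 hb]]; exists (b * (n + 1)); split=> [|d d0].
  by apply: mul_gt0 => //; exists n; ring.
rewrite asuccE => /leS[/(hb _ d0) [e ->]|->]; first by exists (e * (n + 1)); ring.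
by exists b; ring.
Qed.

Definition modulus b i := asucc (asucc i * b).
Definition coprime x m := exists u v, u * x = 1 + v * m.

Lemma coprime_mul x y m : coprime x m -> coprime y m -> coprime (x * y) m.
Proof.
move=> [u [v e]] [u' [v' e']]; exists (u * u'), (v + v' + v * v' * m).
have -> : u * u' * (x * y) = (u * x) * (u' * y) by ring.
by rewrite e e'; ring.
Qed.

(* With [I = i + 1], [J = j + 1] and [b = (J - I) e] one has
   [J J e (1 + I b) + 1 = (J I e + 1) (1 + J b)], an inverse up to sign, and
   [(y + 1)^2 = 1 + y (y + 2)] removes the sign. *)
Lemma coprime_modulus b i j n : 0 < b ->
  (forall d, 0 < d -> d <= n -> exists e, b = d * e) ->
  i < j -> j <= n -> coprime (modulus b i) (modulus b j).
Proof.
move=> b0 hb [d <-] hn.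
have [||e be] := hb (asucc d).
- by exists d; ring.
- by apply: le_trans hn; exists i; ring.
have e0 : 0 < e.
  by apply: lt0_neq => e0; move: b0; rewrite be e0 mul0 => /not_lt0.
set I := i + 1; set J := i + asucc d + 1.
have [y hy] : exists y, J * J * e * modulus b i = y + 1.
  case: (zero_or_succ (J * J * e * modulus b i)) => // h.
  case: (@not_lt0 0); rewrite -{2}h; do !apply: mul_gt0 => //.
  - by exists (i + asucc d); rewrite /J; ring.
  - by exists (i + asucc d); rewrite /J; ring.
  - by exists (asucc i * b); rewrite /modulus; ring.
exists (J * J * e * modulus b i * (J * J * e)), (y * (J * I * e + 1)).
have h2 : J * J * e * modulus b i + 1 =
          (J * I * e + 1) * modulus b (i + asucc d).
  by rewrite /modulus /J /I be; ring.
transitivity ((J * J * e * modulus b i) * (J * J * e * modulus b i)).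
  by ring.
transitivity (1 + y * ((J * I * e + 1) * modulus b (i + asucc d))).
  by rewrite -h2 hy; ring.
by ring.
Qed.

(** [P] is the product of the moduli of index below [k]. In the Chinese remainder step its multiples
    leave the earlier remainders alone, while it is invertible for the next modulus. *)
Lemma moduli_product b n : 0 < b ->
  (forall d, 0 < d -> d <= n -> exists e, b = d * e) ->
  forall k : M, k <= n -> exists P,
    (forall i, i < k -> exists q, P = q * modulus b i) /\
    (forall j, k <= j -> j <= n -> coprime P (modulus b j)).
Proof.
move=> b0 hb; apply: ind; first by rewrite /coprime /modulus; definable.
  move=> _; exists 1; split=> [i /not_lt0 []|j _ _].
  by exists 1, 0; ring.
move=> k IH; rewrite asuccE => hk.
have [|P [hP cP]] := IH; first by apply: le_trans hk; apply: le_addr.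
exists (P * modulus b k); split=> [i /ltS /lt_or_eq [/hP [q ->]|->]|j hj jn].
- by exists (q * modulus b k); ring.
- by exists P.
- apply: coprime_mul.
    by apply: cP => //; apply: le_trans hj; apply: le_addr.
  by apply: coprime_modulus jn => //; apply/ltE.
Qed.

Lemma beta_code (f : M -> M) n : DefF1 f ->
  exists a b, forall i, i <= n -> bt a b i = f i.
Proof.
move=> hf; have [B hB] := bounded_image n hf.
(* The factor [c] makes the moduli coprime; the factor [B + 1] makes them larger than all values of
   [f] to be coded. *)
have [c [c0 hc]] := common_multiple n; pose b := c * (B + 1).
have b0 : 0 < b by apply: mul_gt0 => //; exists B; ring.
have hb d : 0 < d -> d <= n -> exists e, b = d * e.
  by move=> h /(hc _ h) [e ce]; exists (e * (B + 1)); rewrite /b ce; ring.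
have fb i : i <= n -> f i < modulus b i.
  move=> /hB h; apply: le_lt_trans h _; move: c0 => [c' cE].
  exists (c' * (B + 1) + i * b + 1); rewrite /modulus.
  have bE : b = asucc c' * (B + 1) by rewrite /b -cE; ring.
  have -> : asucc i * b = i * b + b by ring.
  by set t := i * b; rewrite bE; ring.
suff [a ha] : exists a, forall i, i < n + 1 ->
    exists q, a = q * modulus b i + f i.
  exists a, b => i hi; apply/esym/btP; split; last exact: fb.
  exact/ha/ltS.
suff H (k : M) : k <= n + 1 -> exists a, forall i, i < k ->
    exists q, a = q * modulus b i + f i.
  exact/H/lexx.
apply: (ind (A := fun k : M => k <= n + 1 -> exists a, forall i, i < k ->
  exists q, a = q * modulus b i + f i)) k.
- by rewrite /modulus; definable.
- by move=> _; exists 0 => i /not_lt0.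
move=> k IH; rewrite asuccE => hk.
have kn : k <= n by apply/ltS/ltE.
have [|a ha] := IH; first by apply: le_trans kn _; apply: le_addr.
have [P [hP cP]] := moduli_product b0 hb kn.
have [u [v uv]] := cP k (lexx k) kn.
pose w := asucc k * b.
(* The modulus is [asucc w], so [w] acts as -1 and [f k + a * w] as [f k - a], without subtraction.
   Since [u * P] is 1 modulo it, the new code has remainder [f k]. *)
exists (a + P * (u * (f k + a * w))) => i /ltS /lt_or_eq [ik|->].
  have [q e] := ha i ik; have [q' e'] := hP i ik.
  by exists (q + q' * (u * (f k + a * w))); rewrite {1}e e'; ring.
exists (a + v * (f k + a * w)).
have -> : P * (u * (f k + a * w)) = (u * P) * (f k + a * w) by ring.
by rewrite uv /modulus -/w; ring.
Qed.

(** * Definable recursion and binary digits *)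

Definition iterates (F : M -> M) z n y := exists a b, bt a b 0 = z /\
  (forall i, i < n -> bt a b (asucc i) = F (bt a b i)) /\ y = bt a b n.

Lemma iterates_exists (F : M -> M) z n : DefF1 F -> exists y, iterates F z n y.
Proof.
move=> hF; apply: (ind (A := fun n => exists y, iterates F z n y)) n.
- by rewrite /iterates; definable.
- have [|a [b hab]] := @beta_code (fun=> z) 0; first by definable.
  exists (bt a b 0), a, b; split; first exact/hab/lexx.
  by split=> // i /not_lt0.
move=> n [_ [a [b [h0 [hS _]]]]].
(* The old code gives no control over entry [n + 1], so the prolonged sequence, which is definable
   from the old code, is coded afresh. *)
pose f i := if pselect (i <= n) then bt a b i else F (bt a b n).
have [|a' [b' hab]] := @beta_code f (n + 1).
  apply: (DefF_graph (G := fun y e => (e 0%N <= n /\ y = bt a b (e 0%N)) \/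
                          (~ e 0%N <= n /\ y = F (bt a b n)))); last by definable.
  move=> y e; rewrite /f; case: pselect => h; split=> [[[]|[]]|] //; by [left|right].
have fle i : i <= n -> bt a' b' i = bt a b i.
  move=> h; rewrite hab; first by rewrite /f; case: pselect.
  by apply: le_trans h _; apply: le_addr.
exists (bt a' b' (asucc n)), a', b'; split; first by rewrite fle //; apply: le0x.
split=> // i; rewrite (asuccE n) => /ltS h; rewrite [in RHS]fle //.
case: (lt_or_eq h) => [h'|->].
  by rewrite fle ?hS // asuccE; apply/ltE.
rewrite asuccE hab; last exact: lexx.
by rewrite /f; case: pselect => // /le_not_lt []; apply: lt_addS.
Qed.

Lemma iterates_unique (F : M -> M) z n y y' :
  iterates F z n y -> iterates F z n y' -> y = y'.
Proof.
move=> [a [b [h0 [hS ->]]]] [a' [b' [h0' [hS' ->]]]].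
suff H (k : M) : k <= n -> bt a b k = bt a' b' k by apply/H/lexx.
apply: (ind (A := fun k : M => k <= n -> bt a b k = bt a' b' k)) k.
- by definable.
- by rewrite h0 h0'.
move=> k IH; rewrite asuccE => /ltE h.
by rewrite -asuccE hS // hS' // IH //; apply: lt_le.
Qed.

(** The values of [G] come from choice in the metatheory; [G] is definable because uniqueness makes
    [iterates] its graph. *)
Lemma recursion (F : M -> M) z : DefF1 F ->
  exists G : M -> M, [/\ DefF1 G, G 0 = z, forall n, G (asucc n) = F (G n) &
    forall n y, y = G n <-> iterates F z n y].
Proof.
move=> hF; have ex n := cid (iterates_exists z n hF).
pose G n := projT1 (ex n).
have GP n y : y = G n <-> iterates F z n y.
  have h : iterates F z n (G n) by rewrite /G; case: (ex n).
  by split=> [->|h'] //; apply: iterates_unique h' h.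
exists G; split=> //.
- apply: (DefF_graph (G := fun y e => iterates F z (e 0%N) y)).
    by move=> y e; rewrite GP.
  by rewrite /iterates; definable.
- have [a [b [h [_ ->]]]] := (GP 0 (G 0)).1 erefl; exact: h.
move=> n; have [a [b [h [hS ->]]]] := (GP (asucc n) _).1 erefl.
rewrite hS; last by rewrite asuccE; apply: lt_addS.
congr F; apply/GP; exists a, b; split=> //; split=> // i hi.
by apply: hS; apply: lt_trans hi _; rewrite asuccE; apply: lt_addS.
Qed.

Let doubleF : DefF1 (fun x : M => x + x).
Proof. by definable. Qed.

Definition pw : M -> M := projT1 (cid (recursion 1 doubleF)).

Lemma DefF_pw : DefF1 pw.
Proof. by rewrite /pw; case: cid => G []. Qed.

Lemma pw0 : pw 0 = 1.
Proof. by rewrite /pw; case: cid => G []. Qed.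

Lemma pwS n : pw (n + 1) = pw n + pw n.
Proof. by rewrite -asuccE /pw; case: cid => G []. Qed.

(** [aexp2] asserts a beta-coded doubling sequence, which is the recursion behind [pw]; this links
    [HF_mem] to [pw]. *)
Lemma pwE n p : aexp2 n p <-> p = pw n.
Proof.
have -> : p = pw n <-> iterates (fun x => x + x) 1 n p.
  by rewrite /pw; case: cid => G /= [].
split=> -[a [b [h0 [hS hn]]]]; exists a, b.
  split; first exact/esym/btP; split; last exact/btP.
  by move=> i /hS [v [/btP -> /btP ->]].
split; first exact/btP/esym; split; last exact/btP.
by move=> i /hS h; exists (bt a b i); split; apply/btP.
Qed.

Ltac definable_ext ::= match goal with
  | |- DefF (fun e => bt _ _ _) => apply: DefF_bt
  | |- DefF (fun e => pw _) => apply: (DefF_app1 DefF_pw)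
  end.

Lemma pwD x y : pw (x + y) = pw x * pw y.
Proof.
apply: (ind (A := fun y => pw (x + y) = pw x * pw y)) y; [definable | |].
  by rewrite add0 pw0; ring.
by move=> y IH; rewrite asuccE addA !pwS IH; ring.
Qed.

Lemma pw_gt0 x : 0 < pw x.
Proof.
apply: (ind (A := fun x => 0 < pw x)) x; [definable | |].
  by rewrite pw0; exists 0; ring.
by move=> x [d h]; rewrite asuccE pwS -h; exists (d + d + 1); ring.
Qed.

Lemma lt_pw x : x < pw x.
Proof.
apply: (ind (A := fun x => x < pw x)) x; [definable | |].
  exact: pw_gt0.
move=> x [d h]; rewrite asuccE pwS -{1}h; have [c <-] := pw_gt0 x.
by exists (c + d); ring.
Qed.

Lemma pw_le x y : x <= y -> pw x <= pw y.
Proof. by move=> [d ->]; rewrite pwD; apply/le_mulr/pw_gt0. Qed.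

Lemma memE n m :
  HF_mem n m <-> exists q r, r < pw n /\ m = (q + q + 1) * pw n + r.
Proof.
rewrite HF_memE; split=> [[p [q [r [/pwE -> [h ->]]]]]|[q [r [h ->]]]].
  by exists q, r; split=> //; ring.
by exists (pw n), q, r; split; [apply/pwE|split=> //; ring].
Qed.

Lemma Def_mem (s t : (nat -> M) -> M) : DefF s -> DefF t ->
  Def (fun e => HF_mem (s e) (t e)).
Proof.
apply: Def_app2; apply: (Def_ext (P := fun e => exists q r, r < pw (e 0%N) /\
  e 1%N = (q + q + 1) * pw (e 0%N) + r)) => [e|]; first by rewrite memE.
by definable.
Qed.

Ltac definable_ext ::= match goal with
  | |- DefF (fun e => bt _ _ _) => apply: DefF_bt
  | |- DefF (fun e => pw _) => apply: (DefF_app1 DefF_pw)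
  | |- Def (fun e => HF_mem _ _) => apply: Def_mem
  end.

Lemma mem_le n m : HF_mem n m -> pw n <= m.
Proof. by move=> /memE [q [r [_ ->]]]; exists ((q + q) * pw n + r); ring. Qed.

Lemma mem_lt n m : HF_mem n m -> n < m.
Proof. by move/mem_le; apply: lt_le_trans; apply: lt_pw. Qed.

Lemma pw_ltI x y : pw x < pw y -> x < y.
Proof. by move=> h; case: (le_or_lt y x) => // /pw_le /le_not_lt. Qed.

Lemma mem0 n : ~ HF_mem n 0.
Proof. by move=> /mem_lt /not_lt0. Qed.

Lemma mem_add_pw B X x : X < pw B ->
  HF_mem x (X + pw B) <-> HF_mem x X \/ x = B.
Proof.
(* For [y] below [B], adding [pw B] changes the quotient by [pw y] by an even number, so bit [y]
   stays the same. *)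
move=> hX; have split_pw y e : y + asucc e = B -> pw B = pw y * (pw e + pw e).
  by move=> <-; rewrite pwD asuccE pwS.
split=> [/memE [q [r [hr e]]]|[hx|->]].
- case: (le_or_lt x B) => [/lt_or_eq [[d dE]|]|]; [left|by right|].
    have [Q [r' [XE hr']]] := div_exists X (pw_gt0 x).
    have E : (q + q + 1) * pw x + r = (Q + (pw d + pw d)) * pw x + r'.
      by rewrite -e (split_pw _ _ dE) {1}XE; ring.
    have [E1 E2] := div_unique hr hr' E.
    apply/memE; have [k [kE|kE]] := parity Q; last by exists k, r'; rewrite XE kE.
    by case: (@odd_not_even q (k + pw d)); rewrite E1 kE; ring.
  move=> Bx; case: (@lt_irrefl (pw x)).
  apply: (@le_lt_trans (X + pw B)).
    by rewrite e; exists ((q + q) * pw x + r); ring.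
  apply: (@lt_le_trans (pw B + pw B)).
    by move: hX => [c cE]; exists c; rewrite -{2}cE; ring.
  by rewrite -pwS; apply: pw_le; apply/ltE.
- have [d dE] : x < B by apply: pw_ltI; apply: le_lt_trans hX; apply: mem_le.
  move/memE: hx => [q [r [hr XE]]]; apply/memE.
  by exists (q + pw d), r; split=> //; rewrite {1}XE (split_pw _ _ dE); ring.
- by apply/memE; exists 0, X; split=> //; ring.
Qed.

(** The code is built bit by bit by induction in [M] on [B], adding [pw B] whenever [A B] holds; so
    [B] may be nonstandard. *)
Lemma comprehension (A : M -> Prop) B : Def1 A -> exists X,
  X < pw B /\ forall x, HF_mem x X <-> x < B /\ A x.
Proof.
move=> hA; apply: (ind (A := fun B => exists X,
  X < pw B /\ forall x, HF_mem x X <-> x < B /\ A x)) B; first by definable.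
  exists 0; split; first exact: pw_gt0.
  by move=> x; split=> [/mem0 //|[/not_lt0]].
move=> B [X [hX XP]]; rewrite asuccE.
case: (pselect (A B)) => hB.
- exists (X + pw B); split.
    by rewrite pwS; move: hX => [c cE]; exists c; rewrite -{2}cE; ring.
  move=> x; rewrite (mem_add_pw _ hX) XP ltS; split.
    by move=> [[/lt_le]|->] //; split=> //; apply: lexx.
  by move=> [/lt_or_eq [] ]; [left|right].
exists X; split; first by apply: lt_le_trans hX _; apply: pw_le; apply: le_addr.
move=> x; rewrite XP ltS; split=> -[]; first by move/lt_le.
by move=> /lt_or_eq [//|-> /hB].
Qed.

(** [T] iterates [pw] from [z]. The growth condition is an equality for consecutive arguments, and
    later steps only increase [T]. *)
Lemma tower_exists z : exists T : M -> M, (forall x, z <= T x) /\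
  forall x y, x < y -> pw (T x) <= T y.
Proof.
have [T [dT T0 TS _]] := recursion z DefF_pw.
have Tpw x y : x < y -> pw (T x) <= T y.
  apply: (ind (A := fun y => x < y -> pw (T x) <= T y)) y; first by definable.
    by move=> /not_lt0.
  move=> y IH; rewrite {1}asuccE TS => /ltS /lt_or_eq [/IH h|->]; last exact: lexx.
  by apply: le_trans h _; apply/lt_le/lt_pw.
exists T; split=> // x; rewrite -T0.
case: (zero_or_succ x) => [->|[y ->]]; first exact: lexx.
apply: le_trans (Tpw 0 (y + 1) _); first exact/lt_le/lt_pw.
by exists y; ring.
Qed.

(** * Nonstandard numbers and levels *)

Definition num k : M := iter k (@asucc M) 0.

Lemma num_add k l : num (k + l)%N = num k + num l.
Proof. by elim: l => [|l IH]; rewrite ?addn0 ?add0 // addnS /= IH addS. Qed.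

Lemma num_mul k l : num (k * l)%N = num k * num l.
Proof. by elim: l => [|l IH]; rewrite ?muln0 ?mul0 // mulnSr num_add IH mulS. Qed.

Lemma num_lt k l : (k < l)%N -> num k < num l.
Proof.
elim: l => // l IH; rewrite ltnS leq_eqVlt => /orP[/eqP ->|/IH h];
  rewrite /= asuccE; apply/ltS; [exact: lexx|exact: lt_le].
Qed.

Lemma num_inj k l : num k = num l -> k = l.
Proof.
by case: (ltngtP k l) => // /num_lt h e; move: h; rewrite e => /lt_irrefl.
Qed.

Lemma le_num x k : x <= num k -> exists l, x = num l.
Proof.
elim: k => [/le_x0 ->|k IH]; first by exists 0%N.
by rewrite /= asuccE => /leS[/IH //|->]; exists k.+1; rewrite -asuccE.
Qed.

(** The standard numbers form an initial segment; if no element lay above all of them, [num] would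
    be an isomorphism from [nat_arith]. *)
Lemma nonstandard_exists : nonstandard M -> exists c, forall k, num k < c.
Proof.
move=> hM; apply: contrapT => h; apply: hM.
have surj x : exists k, num k = x.
  apply: contrapT => hx; apply: h; exists x => k.
  by case: (le_or_lt x (num k)) => // /le_num [l e]; case: hx; exists l.
exists num; split; [|by []|by []|exact: num_add|exact: num_mul].
exists (fun x => projT1 (cid (surj x))) => [k|x]; last by case: cid.
by apply: num_inj; case: cid.
Qed.

Definition gap x y := forall k, x + num k < y.

Lemma gap_lt x y : gap x y -> x < y.
Proof. by move/(_ 0%N); rewrite /= add0. Qed.

(** Half of a nonstandard distance is nonstandard, so the midpoint serves. *)
Lemma gap_split x y : gap x y -> exists z, gap x z /\ gap z y.
Proof.
move=> g; have [d yE] := lt_le (gap_lt g).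
have [h [k_even k_odd]] : exists h, h + h <= d /\ d <= h + h + 1.
  have [h [->|->]] := parity d; exists h; split; try exact: lexx; exact: le_addr.
have hk k : num k < h.
  case: (le_or_lt h (num k)) => // hn.
  case: (@le_not_lt y (x + num (k + k).+1)); last exact: g.
  rewrite yE /= asuccE num_add; apply: leD; first exact: lexx.
  by apply: le_trans k_odd _; apply: leD; [apply: leD|apply: lexx].
exists (x + h); split=> k; have [c hc] := hk k.
  by rewrite -hc; exists c; ring.
by move: k_even => [e ->] in yE *; rewrite yE -{2}hc; exists (c + e); ring.
Qed.

Lemma le_gap x y z : x <= y -> gap y z -> gap x z.
Proof.
by move=> h g k; apply: le_lt_trans (g k); apply: leD => //; apply: lexx.
Qed.

Lemma gap_le x y z : gap x y -> y <= z -> gap x z.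
Proof. by move=> g h k; apply: lt_le_trans (g k) h. Qed.


Lemma max_exists (P : nat -> Prop) (f : nat -> M) z l : exists lo,
  [/\ lo = z \/ exists k, (k < l)%N /\ P k /\ lo = f k,
      z <= lo & forall k, (k < l)%N -> P k -> f k <= lo].
Proof.
elim: l => [|l [lo [h zlo hlo]]]; first by exists z; split=> //; [left|apply: lexx].
have keep : lo = z \/ exists k, (k < l.+1)%N /\ P k /\ lo = f k.
  by case: h => [->|[k [kl h]]]; [left|right; exists k; rewrite ltnS (ltnW kl)].
case: (pselect (P l /\ lo < f l)) => [[Pl lt]|hl].
  exists (f l); split; first by right; exists l.
    exact: le_trans zlo (lt_le lt).
  move=> k; rewrite ltnS leq_eqVlt => /orP[/eqP -> _|kl Pk]; first exact: lexx.
  by apply: le_trans (lt_le lt); apply: hlo.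
exists lo; split=> // k.
rewrite ltnS leq_eqVlt => /orP[/eqP -> Pl|kl Pk]; last exact: hlo.
by case: (le_or_lt (f l) lo) => // h'; case: hl.
Qed.

Lemma min_exists (P : nat -> Prop) (f : nat -> M) z l : exists hi,
  [/\ hi = z \/ exists k, (k < l)%N /\ P k /\ hi = f k,
      hi <= z & forall k, (k < l)%N -> P k -> hi <= f k].
Proof.
elim: l => [|l [hi [h zhi hhi]]]; first by exists z; split=> //; [left|apply: lexx].
have keep : hi = z \/ exists k, (k < l.+1)%N /\ P k /\ hi = f k.
  by case: h => [->|[k [kl h]]]; [left|right; exists k; rewrite ltnS (ltnW kl)].
case: (pselect (P l /\ f l < hi)) => [[Pl lt]|hl].
  exists (f l); split; first by right; exists l.
    exact: le_trans (lt_le lt) zhi.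
  move=> k; rewrite ltnS leq_eqVlt => /orP[/eqP -> _|kl Pk]; first exact: lexx.
  by apply: le_trans (lt_le lt) _; apply: hhi.
exists hi; split=> // k.
rewrite ltnS leq_eqVlt => /orP[/eqP -> Pl|kl Pk]; last exact: hhi.
by case: (le_or_lt hi (f l)) => // h'; case: hl.
Qed.

(** As in Cantor's embedding of countable orders, points are placed one at a time. Keeping
    nonstandard gaps between comparable points leaves room for every later point. *)
Lemma levels_exist (T : nat -> nat -> Prop) c : (forall k, num k < c) ->
  (forall i j k, T i j -> T j k -> T i k) -> (forall i, ~ T i i) ->
  exists f : nat -> M, forall i j, T i j -> f i < f j.
Proof.
move=> hc Ttrans Tirr.
pose Q l (f : nat -> M) v := [/\ gap 0 v, gap v c & forall k, (k < l)%N ->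
  (T k l -> gap (f k) v) /\ (T l k -> gap v (f k))].
have [|l f hf|f hf] := @recursive_choice M 0 Q.
- move=> l f g v fg [h0 hc' h]; split=> // k kl; rewrite -fg //; exact: h.
- have [lo [lo_in lo0 hlo]] := max_exists (T^~ l) f 0 l.
  have [hi [hi_in hic hhi]] := min_exists (T l) f c l.
  have [|v [lov vhi]] := @gap_split lo hi.
    case: lo_in => [->|[i [il [Ti ->]]]]; case: hi_in => [->|[j [jl [Tj ->]]]].
    + by move=> k; rewrite add0x.
    + by have [] := hf j jl.
    + by have [] := hf i il.
    (* The highest predecessor and the lowest successor are comparable by transitivity, so the one
       placed later was given a gap from the other. *)
    have Tij := Ttrans _ _ _ Ti Tj; case: (ltngtP i j) => ij.
    + by have [_ _ /(_ i ij) []] := hf j jl; auto.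
    + by have [_ _ /(_ j ij) []] := hf i il; auto.
    + by move: Tij; rewrite ij => /Tirr.
  exists v; split; [exact: le_gap lov|exact: gap_le vhi hic|].
  move=> k kl; split=> h; first exact: le_gap (hlo _ kl h) lov.
  exact: gap_le vhi (hhi _ kl h).
exists f => i j Tij; apply: gap_lt; case: (ltngtP i j) => ij.
- by have [_ _ /(_ i ij) []] := hf j; auto.
- by have [_ _ /(_ j ij) []] := hf i; auto.
- by move: Tij; rewrite ij => /Tirr.
Qed.

(** * The embedding *)

(* Membership in the [n]-th set is prescribed outright for the earlier sets,
   for [num 0], ..., [num n] and for [c]; any other [x] belongs to it iff
   [num n] belongs to [x]. So [num n] acts as a tag by which each later set
   announces whether it is to be a member of the [n]-th one. *)
Definition prescribed (R : nat -> nat -> Prop) c l (f : nat -> M) x :=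
  (exists k, (k < l)%N /\ (x = f k /\ R k l)) \/
  (exists k, (k < l)%N /\ (x = num k /\ R l k)) \/
  x = num l \/ x = c \/
  (~ (exists k, (k < l.+1)%N /\ x = num k) /\
   ~ (exists k, (k < l)%N /\ x = f k) /\ HF_mem (num l) x).

Lemma embed_nat (R : nat -> nat -> Prop) c :
  (forall k, num k < c) -> acyclic R ->
  exists2 f : nat -> M, injective f & forall i j, R i j <-> HF_mem (f i) (f j).
Proof.
move=> hc acy.
have [lev hlev] : exists lev : nat -> M, forall i j, R i j -> lev i < lev j.
  have [|//|lev h] := levels_exist (T := clos_trans nat R) hc.
    by move=> i j k; apply: t_trans.
  by exists lev => i j Rij; apply: h; apply: t_step.
(* Starting the tower above [c] puts [c] and all tags [num k] below every bound [B l]. *)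
have [T [cT Tpw]] := tower_exists (c + 1).
pose B l := T (lev l).
have cB l : c < B l by apply/ltE/cT.
have numB k l : num k < B l by apply: lt_trans (hc k) (cB l).
pose Q l f X := X < pw (B l) /\
  forall x, HF_mem x X <-> x < B l /\ prescribed R c l f x.
have [|l f _|X hX] := @recursive_choice M 0 Q.
- move=> l f g v fg [h0 h]; split=> // x; rewrite h /prescribed.
  have -> : (exists k, (k < l)%N /\ (x = f k /\ R k l)) <->
            (exists k, (k < l)%N /\ (x = g k /\ R k l)).
    by split=> -[k [kl h1]]; exists k; split=> //; move: h1; rewrite fg.
  have -> // : (exists k, (k < l)%N /\ x = f k) <->
               (exists k, (k < l)%N /\ x = g k).
  by split=> -[k [kl h1]]; exists k; split=> //; move: h1; rewrite fg.
(* The quantifiers over [k] are finite disjunctions, and the sets chosen so far and [c] are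
   parameters. *)
- apply: comprehension; rewrite /prescribed.
  by definable; apply: Def_bounded_ex => k; definable.
have memX l x : HF_mem x (X l) <-> x < B l /\ prescribed R c l X x.
  by have [] := hX l.
(* Having [c] as a member lifts every chosen set above all standard numbers, so no set is mistaken
   for a tag or for [c]. *)
have cX l : c < X l.
  by apply/mem_lt/memX; split; [apply: cB|right; right; right; left].
have Xnum l k : X l <> num k.
  by move=> e; apply: (@lt_irrefl c); apply: lt_trans (hc k); rewrite -e.
have tag_self l : HF_mem (num l) (X l).
  by apply/memX; split; [apply: numB|right; right; left].
have tag i j : (i < j)%N -> HF_mem (num i) (X j) <-> R j i.
  move=> ij; rewrite memX; split; last first.
    by move=> h; split; [apply: numB|right; left; exists i].
  move=> [_ [[k [_ [/esym /Xnum]]]//|[[k [_ [/num_inj -> ]]]//|[/num_inj e|[e|[h _]]]]]].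
  - by move: ij; rewrite e ltnn.
  - by move: (hc i); rewrite e => /lt_irrefl.
  - by case: h; exists i; rewrite ltnS (ltnW ij).
have X_lt_B i j : R i j -> X i < B j.
  move=> /hlev /Tpw; apply: lt_le_trans; exact: (hX i).1.
(* If [X j] differs from the sets before [X i], it is no exception for [X i], and its tag [num i]
   decides membership. *)
have later i j : (forall k, (k < i)%N -> X k <> X j) -> (i < j)%N -> R j i ->
    HF_mem (X j) (X i).
  move=> fresh ij Rji; apply/memX; split; first exact: X_lt_B.
  right; right; right; right; split; first by move=> [k [_ /Xnum]].
  by split; [move=> [k [/fresh h /esym]]|apply/tag].
(* If [X i = X j], the tag [num i], always in [X i], is in [X j]; hence [R j i], and [X j] is a
   member of [X i], that is, of itself. Induction on [i] supplies the freshness that [later] asks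
   for. *)
have neq i : forall j, (i < j)%N -> X i <> X j.
  elim/ltn_ind: i => i IH j ij e.
  have Rji : R j i by apply/(tag _ _ ij); rewrite -e.
  have := later i j _ ij Rji; rewrite -e => h; apply: (@lt_irrefl (X i)).
  apply/mem_lt/h => k ki; exact: IH.
have injX : injective X.
  by move=> i j; case: (ltngtP i j) => // /neq h => [/h//|/esym/h].
exists X => // i j; case: (ltngtP i j) => ij; last 1 first.
- rewrite ij; split; first by move/(t_step nat R)/acy.
  by move/mem_lt/lt_irrefl.
- rewrite memX; split=> [h|]; first by split; [apply: X_lt_B|left; exists i].
  move=> [_ [[k [_ [/injX -> ]]]//|[[k [_ [/Xnum]]]//|[/Xnum//|[e|[_ [h _]]]]]]].
  + by move: (cX i); rewrite e => /lt_irrefl.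
  + by case: h; exists i.
- split=> [|/memX [_]].
    by apply: later => // k ki; apply: neq; apply: ltn_trans ij.
  move=> [[k [kj [/injX e]]]|[[k [_ [/Xnum]]]//|[/Xnum//|[e|[_ [_ h]]]]]].
  + by move: ij; rewrite e ltnNge (ltnW kj).
  + by move: (cX i); rewrite e => /lt_irrefl.
  + by apply/(tag j i).
Qed.

End Arithmetic.

(** * Transfer to countable structures and to models of KP *)

Lemma isomorphic_to_submodel_inj (G H : Type) (R : G -> G -> Prop)
    (S : H -> H -> Prop) (f : G -> H) :
  injective f -> (forall x y, R x y <-> S (f x) (f y)) ->
  isomorphic_to_submodel R S.
Proof.
move=> inj_f hf; pose A : set H := range f.
have fA x : f x \in A by apply/mem_set; exists x.
exists A, (fun x => exist _ (f x) (fA x)) => //.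
have surj (u : A) : exists x, f x = val u.
  by have /set_mem [x _ e] := valP u; exists x.
exists (fun u => projT1 (cid (surj u))) => [x|u].
  by apply: inj_f; case: cid.
by apply: val_inj => /=; case: cid.
Qed.

(** An injection into [nat] carries [R] to [nat], with the numbers outside its range as isolated
    points; so finite and infinite [G] are treated alike. *)
Lemma embed_countable (M : arith) (G : Type) (R : G -> G -> Prop) :
  PA_model M -> nonstandard M -> countable [set: G]%classic -> acyclic R ->
  isomorphic_to_submodel R (@HF_mem M).
Proof.
move=> hPA hM /countable_injP [g g_inj] acy.
have {}g_inj : injective g by move=> x y; apply: g_inj; rewrite inE.
pose R' i j := exists x y, [/\ g x = i, g y = j & R x y].
have R'R i j : clos_trans nat R' i j ->
    exists x y, [/\ g x = i, g y = j & clos_trans G R x y].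
  elim=> [k l [x [y [gx gy h]]]|k l m _ [x [y [gx gy h]]] _ [y' [z [gy' gz h']]]].
    by exists x, y; split=> //; apply: t_step.
  exists x, z; split=> //; apply: t_trans h _.
  by rewrite (g_inj y y') // gy.
have acy' : acyclic R'.
  by move=> i /R'R [x [y [<- /g_inj ->]]]; apply: acy.
have [c hc] := nonstandard_exists hPA hM.
have [f f_inj hf] := embed_nat hPA hc acy'.
apply: (isomorphic_to_submodel_inj (f := f \o g)); first exact: inj_comp.
move=> x y; rewrite /= -hf; split=> [h|[x' [y' [/g_inj -> /g_inj ->]]]//].
by exists x, y.
Qed.

(** [s] lists the vertices of a path after its start. For a cycle [x] itself is listed, so every
    listed vertex has a listed predecessor. *)
Lemma clos_trans_chain (N : Type) (E : N -> N -> Prop) x y :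
  clos_trans N E x y -> exists s : seq N, List.In y s /\
    forall z, List.In z s -> exists2 w, E w z & w = x \/ List.In w s.
Proof.
elim=> [{}x {}y Exy|{}x {}y z _ [s [ys hs]] _ [t [zt ht]]].
  by exists [:: y]; split; [left|move=> z [<-|//]; exists x => //; left].
exists (s ++ t); split; first by apply/List.in_or_app; right.
move=> u hu.
case: (List.in_app_or _ _ _ hu) => [/hs|/ht] [w Ewu h]; exists w => //.
  by case: h; [left|right; apply/List.in_or_app; left].
by right; apply/List.in_or_app; case: h => [->|]; [left|right].
Qed.

(** Variable 0 is the tested point, so the parameters are variables 1 to [k]. *)
Fixpoint f_eq_some (k : nat) : formula satom :=
  if k is l.+1 then Or (Atom (SEq 0 k)) (f_eq_some l) else Bot.

Lemma ssat_eq_some (N : Type) (E : N -> N -> Prop) (e : nat -> N) x k :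
  ssat E (x .: e) (f_eq_some k) <-> exists2 l, l < k & x = e l.
Proof.
rewrite /ssat; elim: k => [|k IH] /=; first by split=> [|[]].
rewrite IH; split=> [[->|[l lk ->]]|[l]].
- by exists k.
- by exists l => //; apply: ltnW.
- by rewrite ltnS leq_eqVlt => /orP[/eqP -> ->|lk ->]; [left|right; exists l].
Qed.

Lemma In_nthP (N : Type) (x0 x : N) (s : seq N) :
  List.In x s <-> exists2 l, l < size s & x = nth x0 s l.
Proof.
elim: s => [|y s IH] /=; first by split=> [|[]].
rewrite IH; split=> [[->|[l ls ->]]|[[_ ->|l ls ->]]].
- by exists 0.
- by exists l.+1.
- by left.
- by right; exists l.
Qed.

(** A cycle has finitely many vertices in the metatheory, so they form a class definable from
    parameters, to which the foundation scheme applies even if [E] is ill-founded. *)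
Lemma KP_acyclic (N : Type) (E : N -> N -> Prop) : KP_model E -> acyclic E.
Proof.
move=> hKP x cyc; have [s [xs hs]] := clos_trans_chain cyc.
have satE y : ssat E (y .: nth x s) (f_eq_some (size s)) <-> List.In y s.
  by rewrite ssat_eq_some (In_nthP x).
have [|y /satE /hs [z Ezy zs] min] :=
  KP_foundation hKP (p := f_eq_some (size s)) (e := nth x s).
  by exists x; apply/satE.
by apply: (min z Ezy); apply/satE; case: zs => [->|].
Qed.

Theorem theorem3 (M : arith) (hPA : PA_model M) (hM : nonstandard M) :
  (forall (N : Type) (E : N -> N -> Prop),
     countable [set: N]%classic -> KP_model E ->
     isomorphic_to_submodel E (@HF_mem M)) /\
  (forall (G : Type) (R : G -> G -> Prop),
     countable [set: G]%classic -> acyclic R ->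
     isomorphic_to_submodel R (@HF_mem M)).
Proof.
split=> [N E cN hKP|G R cG hR]; apply: embed_countable => //.
exact: KP_acyclic.
Qed.
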